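(* Suppose that $R$ is a ring such that every left $R$-module is cu-serial. Then $R/\mathrm{J}(R)\cong M_{n_1}(D_1)\times\cdots\times M_{n_k}(D_k)$ for some positive integers $n_1,\dots,n_k$ and some principal left ideal domains $D_1,\dots,D_k$.
   Context: All rings are associative with identity and all modules are unitary left modules. $\mathrm{J}(R)$ is the Jacobson radical and $M_n(D)$ the ring of $n\times n$ matrices over $D$. A principal left ideal domain is a (not necessarily commutative) domain in which every left ideal is principal. For a module $K$, $\mathrm{Rad}(K)$ denotes the intersection of all maximal submodules of $K$ (equal to $K$ if there are none). A nonzero module is uniform if every nonzero submodule is essential. A left $R$-module $M$ is cyclic-uniform uniserial (cu-uniserial) if for every finitely generated submodule $0\neq K\subseteq M$, $K/\mathrm{Rad}(K)$ is cyclic and uniform; $M$ is cu-serial if it is a direct sum of cu-uniserial modules. *)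

(* Defs.v *)
From HB Require Import structures.
From mathcomp Require Import all_boot all_algebra ring_quotient.
From mathcomp Require Import boolp.

Set Implicit Arguments.
Unset Strict Implicit.
Unset Printing Implicit Defensive.

Import GRing.Theory.

Local Open Scope ring_scope.
Local Open Scope quotient_scope.

(* Submodules of M are the bundled predicates [submodClosed M]; by [asbool]    *)
(* every subset of M is the extension of a boolean predicate, so no submodule  *)
(* is lost. Left ideals of R are the submodules of the regular module R^o.     *)

Section Submodule.
Variables (R : pzRingType) (M : lmodType R) (N : submodClosed M).

Record submod := Submod { submod_val : M; _ : submod_val \in N }.

HB.instance Definition _ := [isSub for submod_val].
HB.instance Definition _ := [Choice of submod by <:].
HB.instance Definition _ := [SubChoice_isSubLmodule of submod by <:].

End Submodule.

Section QuotientModule.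
Variables (R : pzRingType) (M : lmodType R) (N : submodClosed M).

(* [submodClosed M] does not inherit from [zmodClosed M], which the library's  *)
(* quotient expects.                                                           *)
Definition submod_zmod : pred M := fun x => x \in N.

Lemma submod_zmodP : zmod_closed submod_zmod.
Proof. exact: GRing.submod_closedB (submodClosedP N). Qed.

Definition submod_zmodClosed : zmodClosed M :=
  HB.pack_for (zmodClosed M) submod_zmod
    (GRing.isZmodClosed.Build M submod_zmod submod_zmodP).

Definition quotmod := Quotient.quot submod_zmodClosed.

HB.instance Definition _ := GRing.Zmodule.on quotmod.
HB.instance Definition _ :=
  ZmodQuotient.copy quotmod (Quotient.quot submod_zmodClosed).

Lemma quotmod_eqP (x y : M) : reflect (x = y %[mod quotmod]) (x - y \in N).
Proof.
have -> : (x - y \in N) = (x == y %[mod quotmod]) :=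
  Quotient.idealrBE submod_zmodClosed x y.
exact: eqP.
Qed.

Lemma quotmod_piD : {morph \pi_quotmod : x y / x + y}.
Proof. by move=> x y; rewrite -pi_addr. Qed.

Definition quotmod_scale (a : R) : quotmod -> quotmod :=
  lift_op1 quotmod ( *:%R a).

Lemma quotmod_scaleE a (x : M) :
  quotmod_scale a (\pi_quotmod x) = \pi_quotmod (a *: x).
Proof.
unlock quotmod_scale; apply/quotmod_eqP; rewrite -scalerBr rpredZ //.
by apply/quotmod_eqP; rewrite reprK.
Qed.

Lemma quotmod_scaleA a b u :
  quotmod_scale a (quotmod_scale b u) = quotmod_scale (a * b) u.
Proof. by rewrite -[u]reprK !quotmod_scaleE scalerA. Qed.

Lemma quotmod_scale1 : left_id 1 quotmod_scale.
Proof. by move=> u; rewrite -[u]reprK quotmod_scaleE scale1r. Qed.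

Lemma quotmod_scaleDr : right_distributive quotmod_scale +%R.
Proof.
move=> a u v; rewrite -[u]reprK -[v]reprK !quotmod_scaleE.
by rewrite -!quotmod_piD quotmod_scaleE scalerDr.
Qed.

Lemma quotmod_scaleDl u : {morph quotmod_scale^~ u : a b / a + b}.
Proof.
by move=> a b /=; rewrite -[u]reprK !quotmod_scaleE -quotmod_piD scalerDl.
Qed.

HB.instance Definition _ := GRing.Zmodule_isLmodule.Build R quotmod
  quotmod_scaleA quotmod_scale1 quotmod_scaleDr quotmod_scaleDl.

End QuotientModule.

Section ModuleNotions.
Variables (R : pzRingType) (M : lmodType R).
Implicit Types N L : submodClosed M.

Definition nonzero_module := exists x : M, x != 0.

Definition nonzero_submodule N := exists2 x, x \in N & x != 0.

Definition cyclic_module := exists g : M, forall x, exists a : R, x = a *: g.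

Definition fg_module :=
  exists (n : nat) (g : 'I_n -> M), forall x : M,
    exists a : 'I_n -> R, x = \sum_i a i *: g i.

Definition essential N :=
  forall L, nonzero_submodule L -> exists x, [/\ x \in N, x \in L & x != 0].

Definition uniform_module :=
  nonzero_module /\ forall N, nonzero_submodule N -> essential N.

Definition maximal_submodule N :=
  (exists x, x \notin N) /\
  forall L, {subset N <= L} -> L =i N \/ (forall x, x \in L).

Definition in_rad : pred M :=
  fun x => `[< forall N, maximal_submodule N -> x \in N >].

Lemma in_rad_closed : submod_closed in_rad.
Proof.
split=> [|a x y /asboolP xr /asboolP yr]; apply/asboolP => N maxN.
  exact: rpred0.
by rewrite rpredD ?rpredZ ?xr ?yr.
Qed.

Definition rad : submodClosed M :=
  HB.pack_for (submodClosed M) in_rad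
    (GRing.isSubmodClosed.Build R M in_rad in_rad_closed).

Lemma radP x : reflect (forall N, maximal_submodule N -> x \in N) (x \in rad).
Proof. exact: asboolP. Qed.

End ModuleNotions.

Arguments rad {R} M.

Definition cu_uniserial (R : pzRingType) (M : lmodType R) :=
  forall K : submodClosed M,
    nonzero_submodule K -> fg_module (submod K) ->
    cyclic_module (quotmod (rad (submod K))) /\
    uniform_module (quotmod (rad (submod K))).

(* Internal direct sum of a possibly infinite family of submodules: every      *)
(* element is a finite sum, and finite sums of components are independent.     *)
Definition direct_sum (R : pzRingType) (M : lmodType R) (I : eqType)
    (N : I -> submodClosed M) :=
  (forall x : M, exists (s : seq I) (f : I -> M),
     [/\ uniq s, forall i, f i \in N i & x = \sum_(i <- s) f i]) /\
  (forall (s : seq I) (f : I -> M),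
     uniq s -> (forall i, f i \in N i) -> \sum_(i <- s) f i = 0 ->
     forall i, i \in s -> f i = 0).

Definition cu_serial (R : pzRingType) (M : lmodType R) :=
  exists (I : eqType) (N : I -> submodClosed M),
    direct_sum N /\ forall i, cu_uniserial (submod (N i)).

Section JacobsonQuotient.
Variable R : pzRingType.

(* The intersection of all maximal left ideals.                                *)
Definition jacobson : submodClosed R^o := rad R^o.

Section Transporter.
Variables (N : submodClosed R^o) (r : R).

Definition in_transporter : pred R^o := fun a => (a : R) * r \in N.

Lemma in_transporter_closed : submod_closed in_transporter.
Proof.
split=> [|a x y xN yN]; rewrite unfold_in /in_transporter.
  by rewrite [X in X \in _](mul0r r); exact: (rpred0 N).
have -> : ((a *: x + y : R^o) : R) * r = a * ((x : R) * r) + (y : R) * r.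
  by rewrite mulrA -mulrDl.
exact (@rpredD _ N (a * (x * r)) (y * r) (@rpredZ _ _ N a (x * r) xN) yN).
Qed.

Definition transporter : submodClosed R^o :=
  HB.pack_for (submodClosed R^o) in_transporter
    (GRing.isSubmodClosed.Build R R^o in_transporter in_transporter_closed).

Lemma transporterE (a : R) : (a \in transporter) = (a * r \in N).
Proof. by []. Qed.

Lemma transporter_maximal :
  maximal_submodule N -> r \notin N -> maximal_submodule transporter.
Proof.
move=> [_ maxN] rN; split=> [|L NL].
  by exists (1 : R); rewrite transporterE mul1r.
have [LN|] := pselect {subset L <= transporter}.
  by left=> x; apply/idP/idP => [/LN|/NL].
move=> /existsNP[a /not_implyP[aL /negP aN]]; right => x.
pose S : pred R^o := fun y => `[< exists (b : R) (m : R^o),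
  m \in N /\ (y : R) = b * (a * r) + m >].
have S_closed : submod_closed S.
  split=> [|c y z /asboolP[b [m [mN ->]]] /asboolP[b' [m' [mN' ->]]]].
    by apply/asboolP; exists 0, 0; rewrite rpred0 mul0r addr0.
  apply/asboolP; exists (c * b + b'), (c *: m + m').
  split; first by rewrite rpredD ?rpredZ.
  by rewrite /GRing.scale /= mulrDr mulrDl !mulrA addrACA.
pose S' := HB.pack_for (submodClosed R^o) S
  (GRing.isSubmodClosed.Build R R^o S S_closed).
have NS : {subset N <= S'}.
  by move=> m mN; apply/asboolP; exists 0, m; rewrite mul0r add0r.
have [SN|/(_ r)/asboolP[b [m [mN rE]]]] := maxN S' NS.
  case/negP: aN; rewrite transporterE -SN.
  by apply/asboolP; exists 1, 0; rewrite rpred0 mul1r addr0.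
have L1 : (1 : R^o) \in L.
  rewrite -[1](subrK (b * a)) rpredD //; last exact (@rpredZ _ _ L b a aL).
  apply: NL; rewrite transporterE mulrBl mul1r -mulrA.
  by rewrite [X in X - _]rE addrC addKr.
have xL : (x : R) * 1 \in L by exact (@rpredZ _ _ L x 1 L1).
by rewrite mulr1 in xL.
Qed.

End Transporter.

Lemma jacobson_mulr (x : R) (r : R) : x \in jacobson -> x * r \in jacobson.
Proof.
move=> /radP xJ; apply/radP => N maxN.
have [rN|rN] := boolP ((r : R^o) \in N); first exact (@rpredZ _ _ N x r rN).
exact: (xJ _ (transporter_maximal maxN rN)).
Qed.

Lemma jacobson_mull (r : R) (x : R) : x \in jacobson -> r * x \in jacobson.
Proof. by move=> xJ; exact (@rpredZ _ _ jacobson r x xJ). Qed.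

Definition jquot := quotmod jacobson.

HB.instance Definition _ := GRing.Zmodule.on jquot.
HB.instance Definition _ := ZmodQuotient.copy jquot (quotmod jacobson).

Lemma jquot_eqP (x y : R) :
  reflect (x = y %[mod jquot]) (x - y \in jacobson).
Proof. exact (@quotmod_eqP _ _ jacobson x y). Qed.

Lemma jquot_piD (x y : R) :
  \pi_jquot (x + y) = \pi_jquot x + \pi_jquot y.
Proof. exact (@quotmod_piD _ _ jacobson x y). Qed.

Definition jquot_one : jquot := \pi_jquot (1 : R).
Definition jquot_mul : jquot -> jquot -> jquot :=
  lift_op2 jquot ( *%R : R -> R -> R).

Lemma jquot_mulE (x y : R) :
  jquot_mul (\pi_jquot x) (\pi_jquot y) = \pi_jquot (x * y).
Proof.
unlock jquot_mul; apply/jquot_eqP; set x' : R := repr _; set y' : R := repr _.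
have xJ : x' - x \in jacobson by apply/jquot_eqP; rewrite reprK.
have yJ : y' - y \in jacobson by apply/jquot_eqP; rewrite reprK.
have -> : x' * y' - x * y = (x' - x) * y' + x * (y' - y).
  by rewrite mulrBl mulrBr addrA subrK.
exact (@rpredD _ jacobson _ _ (jacobson_mulr y' xJ) (jacobson_mull x yJ)).
Qed.

Lemma jquot_mulA : associative jquot_mul.
Proof.
move=> u v w; rewrite -[u]reprK -[v]reprK -[w]reprK.
by rewrite !jquot_mulE mulrA.
Qed.

Lemma jquot_mul1l : left_id jquot_one jquot_mul.
Proof. by move=> u; rewrite -[u]reprK jquot_mulE mul1r. Qed.

Lemma jquot_mul1r : right_id jquot_one jquot_mul.
Proof. by move=> u; rewrite -[u]reprK jquot_mulE mulr1. Qed.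

Lemma jquot_mulDl : left_distributive jquot_mul +%R.
Proof.
move=> u v w; rewrite -[u]reprK -[v]reprK -[w]reprK.
by rewrite !jquot_mulE -!jquot_piD jquot_mulE -mulrDl.
Qed.

Lemma jquot_mulDr : right_distributive jquot_mul +%R.
Proof.
move=> u v w; rewrite -[u]reprK -[v]reprK -[w]reprK.
by rewrite !jquot_mulE -!jquot_piD jquot_mulE -mulrDr.
Qed.

HB.instance Definition _ := GRing.Zmodule_isPzRing.Build jquot
  jquot_mulA jquot_mul1l jquot_mul1r jquot_mulDl jquot_mulDr.

End JacobsonQuotient.

Section ProductRing.
Variables (I : finType) (T : I -> pzRingType).

Definition prodring := {dffun forall i, T i}.

HB.instance Definition _ := Choice.on prodring.

Implicit Types f g h : prodring.

Definition prodring_zero : prodring := [ffun i => 0 : T i].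
Definition prodring_opp f : prodring := [ffun i => - f i].
Definition prodring_add f g : prodring := [ffun i => f i + g i].
Definition prodring_one : prodring := [ffun i => 1 : T i].
Definition prodring_mul f g : prodring := [ffun i => f i * g i].

Lemma prodring_addA : associative prodring_add.
Proof. by move=> f g h; apply/ffunP => i; rewrite !ffunE addrA. Qed.
Lemma prodring_addC : commutative prodring_add.
Proof. by move=> f g; apply/ffunP => i; rewrite !ffunE addrC. Qed.
Lemma prodring_add0 : left_id prodring_zero prodring_add.
Proof. by move=> f; apply/ffunP => i; rewrite !ffunE add0r. Qed.
Lemma prodring_addN : left_inverse prodring_zero prodring_opp prodring_add.
Proof. by move=> f; apply/ffunP => i; rewrite !ffunE addNr. Qed.

HB.instance Definition _ := GRing.isZmodule.Build prodring
  prodring_addA prodring_addC prodring_add0 prodring_addN.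

Lemma prodring_mulA : associative prodring_mul.
Proof. by move=> f g h; apply/ffunP => i; rewrite !ffunE mulrA. Qed.
Lemma prodring_mul1l : left_id prodring_one prodring_mul.
Proof. by move=> f; apply/ffunP => i; rewrite !ffunE mul1r. Qed.
Lemma prodring_mul1r : right_id prodring_one prodring_mul.
Proof. by move=> f; apply/ffunP => i; rewrite !ffunE mulr1. Qed.
Lemma prodring_mulDl : left_distributive prodring_mul prodring_add.
Proof. by move=> f g h; apply/ffunP => i; rewrite !ffunE mulrDl. Qed.
Lemma prodring_mulDr : right_distributive prodring_mul prodring_add.
Proof. by move=> f g h; apply/ffunP => i; rewrite !ffunE mulrDr. Qed.

HB.instance Definition _ := GRing.Zmodule_isPzRing.Build prodring
  prodring_mulA prodring_mul1l prodring_mul1r prodring_mulDl prodring_mulDr.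

End ProductRing.

(* D is not assumed commutative, so [idomainType] is not the right structure;  *)
(* nontriviality is carried by [nzRingType].                                   *)
Definition principal_left_ideal_domain (D : nzRingType) :=
  (forall x y : D, x * y = 0 -> x = 0 \/ y = 0) /\
  (forall L : submodClosed D^o, exists a : D, forall x : D,
     x \in L <-> exists c : D, x = c * a).

Definition ring_isomorphic (A B : pzRingType) :=
  exists f : {rmorphism A -> B}, bijective f.

(* Main.v *)
From HB Require Import structures.
From mathcomp Require Import all_boot all_algebra.
From mathcomp Require Import boolp classical_sets functions.
Require Import Defs.

Set Implicit Arguments.
Unset Strict Implicit.
Unset Printing Implicit Defensive.

Import GRing.Theory.

Local Open Scope ring_scope.

(** The hypothesis is so strong that R/J(R) is semisimple, and the domains D_i
    come out as division rings.

    A cu-uniserial module is uniform: if nonzero u and v had Ru and Rv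
    independent, then K = Ru + Rv would have radical Rad(Ru) + Rad(Rv), and
    K/Rad(K) would be a direct sum of two nonzero modules
    ([cu_uniserial_uniform_on]). So every R-module is a direct sum of uniform
    modules. A uniform module is an essential extension of a cyclic one, and
    this bounds its cardinality by that of the functions R -> R
    ([uniform_on_embedding]). Every R-module is therefore a direct sum of
    modules of bounded size.

    By an argument of Chase, such a bound forces a chain condition. For x in R,
    the functor that sends M to x^n M commutes with direct products and with
    direct sums. If the descending chain x^n R never stopped, then in a product
    of copies of R the quotient x^n M / x^(n+1) M would be too large for the
    finitely many small summands that have to carry it. Hence x^n lies in
    x^(n+1) R for some n ([power_stationary]).

    The R-module S = R/J(R) is a direct sum of uniform left ideals Se, for
    finitely many orthogonal idempotents e. Since J(S) = 0 and the chains
    x^n S stop, an endomorphism of Se with nonzero kernel is zero, and then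
    eSe is a division ring and Se is simple ([uniform_idempotent_minimal]).
    The Wedderburn-Artin decomposition of S concludes ([wedderburn_artin]);
    each block is a matrix ring over some eSe. *)

(** * Submodules *)

Definition submod_of (R : pzRingType) (M : lmodType R) (P : M -> Prop)
    (P_closed : submod_closed (fun x => `[< P x >])) : submodClosed M :=
  HB.pack_for (submodClosed M) (fun x => `[< P x >])
    (GRing.isSubmodClosed.Build R M (fun x => `[< P x >]) P_closed).

Lemma mem_submod_of (R : pzRingType) (M : lmodType R) (P : M -> Prop)
    (P_closed : submod_closed (fun x => `[< P x >])) (x : M) :
  x \in submod_of P_closed <-> P x.
Proof. by split=> [/asboolP|Px] //; apply/asboolP. Qed.

Section Generated.
Variables (R : pzRingType) (M : lmodType R).
Implicit Types (N L : submodClosed M) (x u v : M).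

Lemma submod_closedN N : oppr_closed N.
Proof. by move=> x xN; rewrite -scaleN1r rpredZ. Qed.

Lemma submod_closedB N : {in N &, forall x y, x - y \in N}.
Proof. by move=> x y xN yN; rewrite rpredD ?submod_closedN. Qed.

Lemma adjoin_closed N u :
  submod_closed (fun x => `[< exists a : R, a *: u - x \in N >]).
Proof.
split=> [|a x y /asboolP[b bN] /asboolP[c cN]]; apply/asboolP.
  by exists 0; rewrite scale0r subr0 rpred0.
exists (a * b + c); rewrite scalerDl -scalerA opprD addrACA -scalerBr.
by rewrite rpredD ?rpredZ.
Qed.

(** The submodule N + Ru. *)
Definition adjoin N u : submodClosed M := submod_of (adjoin_closed N u).

Lemma adjoinP N u x : x \in adjoin N u <-> exists a : R, a *: u - x \in N.
Proof. exact: mem_submod_of. Qed.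

Lemma sub_adjoin N u : {subset N <= adjoin N u}.
Proof.
by move=> x xN; apply/adjoinP; exists 0; rewrite scale0r sub0r submod_closedN.
Qed.

Lemma mem_adjoin N u : u \in adjoin N u.
Proof. by apply/adjoinP; exists 1; rewrite scale1r subrr rpred0. Qed.

Lemma zero_closed : submod_closed (fun x => `[< x = 0 >]).
Proof.
by split=> [|a x y /asboolP-> /asboolP->]; apply/asboolP; rewrite ?scaler0 ?addr0.
Qed.

Definition cyclic_span u : submodClosed M := adjoin (submod_of zero_closed) u.

Lemma cyclic_spanP u x : x \in cyclic_span u <-> exists a : R, x = a *: u.
Proof.
rewrite adjoinP; split=> -[a].
  by rewrite mem_submod_of => /eqP; rewrite subr_eq0 => /eqP <-; exists a.
by move=> ->; exists a; rewrite mem_submod_of subrr.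
Qed.

(** Zorn's lemma on the submodules that contain N and avoid u. One that is
    maximal among them is a maximal submodule, because N and u together
    generate M. *)
Lemma exists_maximal_avoiding N u :
  u \notin N -> (forall x, x \in adjoin N u) ->
  exists2 A : submodClosed M,
    maximal_submodule A & u \notin A /\ {subset N <= A}.
Proof.
move=> uN genM.
pose T := {A : submodClosed M | u \notin A /\ {subset N <= A}}.
pose r (A B : T) := `[< {subset sval A <= sval B} >].
have [|||[A [uA NA]] maxA] := @ZL_preorder T (exist _ N (conj uN (fun x p => p))) r.
- by move=> A; apply/asboolP.
- by move=> A B C /asboolP AB /asboolP BC; apply/asboolP => x /AB/BC.
- move=> F totF; have [[B0 FB0]|noF] := pselect (exists B, F B); last first.
    by exists (exist _ N (conj uN (fun x p => p))) => B FB; case: noF; exists B.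
  pose P x := exists2 B : T, F B & x \in sval B.
  have P_closed : submod_closed (fun x => `[< P x >]).
    split=> [|a x y /asboolP[B FB xB] /asboolP[C FC yC]]; apply/asboolP.
      by exists B0 => //; exact: rpred0.
    have [/asboolP BC|/asboolP CB] := totF B C FB FC.
      by exists C => //; rewrite rpredD ?rpredZ // BC.
    by exists B => //; rewrite rpredD ?rpredZ // CB.
  have uP : u \notin submod_of P_closed.
    by apply/negP => /mem_submod_of[[B [uB NB]] FB /=]; apply/negP.
  have NP : {subset N <= submod_of P_closed}.
    by move=> x xN; apply/mem_submod_of; exists B0; rewrite ?(proj2 (svalP B0)).
  exists (exist _ (submod_of P_closed) (conj uP NP)) => B FB.
  by apply/asboolP => x xB; apply/mem_submod_of; exists B.
exists A => //; split=> [|L AL]; first by exists u.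
have [uL|uL] := boolP (u \in L).
  right=> x; have /adjoinP[a auxN] := genM x.
  by rewrite -(subKr (a *: u) x) submod_closedB ?rpredZ // AL ?NA.
left=> x; apply/idP/idP => [|/AL//].
have NL : {subset N <= L} by move=> z /NA/AL.
have := maxA (exist _ L (conj uL NL)) => /(_ _)/asboolP; apply.
exact/asboolP.
Qed.

End Generated.

(** * Cu-uniserial modules are uniform *)

(** Uniformity of N as a condition on elements of the ambient module; it also
    holds of the zero submodule, which a decomposition may contain. *)
Definition uniform_on (R : pzRingType) (M : lmodType R) (N : submodClosed M) :=
  forall u v : M, u \in N -> v \in N -> u != 0 -> v != 0 ->
  exists a b : R, a *: u = b *: v /\ a *: u != 0.

Lemma uniform_module_common_multiple (R : pzRingType) (M : lmodType R) (u v : M) :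
  uniform_module M -> u != 0 -> v != 0 ->
  exists a b : R, a *: u = b *: v /\ a *: u != 0.
Proof.
move=> [_ unifM] u0 v0.
have span_nz (w : M) : w != 0 -> nonzero_submodule (cyclic_span w).
  by move=> w0; exists w => //; apply/cyclic_spanP; exists 1; rewrite scale1r.
have [x [/cyclic_spanP[a ->] /cyclic_spanP[b ab] nz]] :=
  unifM _ (span_nz u u0) _ (span_nz v v0).
by exists a, b.
Qed.

Section TwoGenerated.
Variables (R : pzRingType) (M : lmodType R) (u v : M).
Hypothesis gen_uv : forall x : M, exists a b : R, x = a *: u + b *: v.
Hypothesis indep_uv : forall a b : R, a *: u = b *: v -> a *: u = 0.

Let indep_sum a b c d : a *: u + b *: v = c *: u + d *: v -> a *: u = c *: u.
Proof.
move=> e; apply/eqP; rewrite -subr_eq0 -scalerBl; apply/eqP.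
apply: (@indep_uv _ (d - b)); rewrite !scalerBl; apply/eqP.
by rewrite subr_eq addrAC eq_sym subr_eq addrC -e addrC.
Qed.

(** Since u is not in Rv, some maximal submodule contains v and not u. *)
Lemma generator_notin_rad : u != 0 -> u \notin rad M.
Proof.
move=> u0.
have uV : u \notin cyclic_span v.
  apply/negP => /cyclic_spanP[b ub]; case/eqP: u0.
  by rewrite -[u]scale1r; apply: (@indep_uv 1 b); rewrite scale1r.
have [|A maxA [uA _]] := exists_maximal_avoiding uV.
  move=> x; apply/adjoinP; have [a [b ->]] := gen_uv x; exists a.
  by apply/cyclic_spanP; exists (- b); rewrite opprD addrA subrr sub0r scaleNr.
by apply/negP => /radP/(_ A maxA); apply/negP.
Qed.

(** The radical is stable under the projection of Ru (+) Rv onto Ru: the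
    preimage under it of a maximal submodule A not containing u is again
    maximal. *)
Lemma rad_projection a b : a *: u - b *: v \in rad M -> a *: u \in rad M.
Proof.
move=> /radP abrad; apply/radP => A maxA; apply/negPn/negP => auA.
(* P is the preimage of A under the projection onto Ru. *)
pose P x := exists c d, x = c *: u + d *: v /\ c *: u \in A.
have P_closed : submod_closed (fun x => `[< P x >]).
  split=> [|r x y /asboolP[c [d [-> cA]]] /asboolP[c' [d' [-> cA']]]].
    by apply/asboolP; exists 0, 0; rewrite !scale0r addr0 rpred0.
  apply/asboolP; exists (r * c + c'), (r * d + d').
  rewrite !scalerDl -!scalerA scalerDr addrACA; split=> //.
  by apply: rpredD => //; exact: rpredZ.
pose B := submod_of P_closed.
have vB e : e *: v \in B.
  by apply/mem_submod_of; exists 0, e; rewrite scale0r add0r rpred0.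
have auB : a *: u \notin B.
  apply/negP => /mem_submod_of[c [d [e cA]]]; case/negP: auA.
  rewrite -[a *: u]addr0 -[X in _ + X](scale0r v) in e.
  by rewrite (indep_sum e).
suff maxB : maximal_submodule B.
  by case/negP: auB; rewrite -(subrK (b *: v) (a *: u)) rpredD ?vB ?abrad.
split=> [|L BL]; first by exists (a *: u).
have [LB|] := pselect {subset L <= B}.
  by left=> x; apply/idP/idP => [/LB|/BL].
move=> /existsNP[x /not_implyP[xL /negP xB]]; right.
have [c [d xE]] := gen_uv x.
have cuL : c *: u \in L.
  by rewrite -(addrK (d *: v) (c *: u)) -xE submod_closedB // BL ?vB.
have cuA : c *: u \notin A.
  by apply/negP => cuA; case/negP: xB; apply/mem_submod_of; exists c, d.
have [_ /(_ _ (@sub_adjoin _ _ A (c *: u)))[AE|full]] := maxA.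
  by case/negP: cuA; rewrite -AE mem_adjoin.
have uL : u \in L.
  have /adjoinP[r rA] := full u; rewrite -(subKr (r *: (c *: u)) u).
  apply: submod_closedB; first exact: rpredZ.
  apply: BL; apply/mem_submod_of.
  rewrite scalerA -{2}[u]scale1r -scalerBl in rA.
  exists (r * c - 1), 0; rewrite scale0r addr0; split=> //.
  by rewrite scalerA scalerBl scale1r.
move=> y; have [r [s ->]] := gen_uv y.
by apply: rpredD; [exact: rpredZ | exact/BL/vB].
Qed.

End TwoGenerated.

Lemma quotmod_pi_eq0 (R : pzRingType) (M : lmodType R) (N : submodClosed M)
    (x : M) : (\pi_(quotmod N)%qT x == 0) = (x \in N).
Proof.
have -> : 0 = \pi_(quotmod N)%qT 0 by rewrite [RHS]pi_zeror.
by apply/eqP/idP => [/quotmod_eqP|xN]; last apply/quotmod_eqP; rewrite subr0.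
Qed.

Lemma quotmod_scale_pi (R : pzRingType) (M : lmodType R) (N : submodClosed M)
    (a : R) (x : M) : a *: \pi_(quotmod N)%qT x = \pi_(quotmod N)%qT (a *: x).
Proof. exact: quotmod_scaleE. Qed.

(** If Ru and Rv were independent, their images in M/Rad(M) would be nonzero
    with zero intersection. *)
Lemma two_generated_common_multiple (R : pzRingType) (M : lmodType R) (u v : M) :
  (forall x : M, exists a b : R, x = a *: u + b *: v) ->
  uniform_module (quotmod (rad M)) -> u != 0 -> v != 0 ->
  exists a b : R, a *: u = b *: v /\ a *: u != 0.
Proof.
move=> gen_uv unifQ u0 v0; apply: contrapT => no_common.
have indep_uv a b : a *: u = b *: v -> a *: u = 0.
  move=> ab; apply/eqP/negPn/negP => au0; apply: no_common.
  by exists a, b.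
have gen_vu x : exists a b : R, x = a *: v + b *: u.
  by have [a [b ->]] := gen_uv x; exists b, a; rewrite addrC.
have indep_vu a b : a *: v = b *: u -> a *: v = 0.
  by move=> ab; rewrite ab; apply: (indep_uv b a); rewrite ab.
have pi_nz x : x \notin rad M -> \pi_(quotmod (rad M))%qT x != 0.
  by rewrite quotmod_pi_eq0.
have := uniform_module_common_multiple unifQ
  (pi_nz _ (generator_notin_rad gen_uv indep_uv u0))
  (pi_nz _ (generator_notin_rad gen_vu indep_vu v0)).
move=> [a [b []]].
rewrite !quotmod_scale_pi quotmod_pi_eq0 => /quotmod_eqP.
by move=> /(rad_projection gen_uv indep_uv) ->.
Qed.

Lemma cu_uniserial_common_multiple (R : pzRingType) (M : lmodType R) (u v : M) :
  cu_uniserial M -> u != 0 -> v != 0 ->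
  exists a b : R, a *: u = b *: v /\ a *: u != 0.
Proof.
move=> cuM u0 v0; pose K := adjoin (cyclic_span u) v.
have uK : u \in K.
  by apply/sub_adjoin/cyclic_spanP; exists 1; rewrite scale1r.
have vK : v \in K by exact: mem_adjoin.
pose U : submod K := Submod uK; pose V : submod K := Submod vK.
have genK (x : submod K) : exists a b : R, x = a *: U + b *: V.
  have /adjoinP[b /cyclic_spanP[a e]] := valP x; exists (- a), b.
  apply: val_inj; change (val x = - a *: u + b *: v); rewrite scaleNr -e.
  by rewrite opprB subrK.
have nzK : nonzero_submodule K by exists u.
have fgK : fg_module (submod K).
  exists 2%N, (fun i : 'I_2 => if i == 0 :> nat then U else V) => x.
  have [a [b ->]] := genK x.
  exists (fun i : 'I_2 => if i == 0 :> nat then a else b).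
  by rewrite !big_ord_recl big_ord0 addr0.
have [_ unifK] := cuM K nzK fgK.
have nz0 (x : submod K) : val x != 0 -> x != 0.
  by apply: contra => /eqP->; rewrite raddf0.
have [a [b [ab nz]]] :=
  two_generated_common_multiple genK unifK (nz0 U u0) (nz0 V v0).
exists a, b; split; first exact: (congr1 val ab).
by apply: contra nz => /eqP au0; apply/eqP/val_inj.
Qed.

Lemma cu_uniserial_uniform_on (R : pzRingType) (M : lmodType R)
    (N : submodClosed M) : cu_uniserial (submod N) -> uniform_on N.
Proof.
move=> cuN u v uN vN u0 v0.
pose U : submod N := Submod uN; pose V : submod N := Submod vN.
have nz0 (x : submod N) : val x != 0 -> x != 0.
  by apply: contra => /eqP->; rewrite raddf0.
have [a [b [ab nz]]] := cu_uniserial_common_multiple cuN (nz0 U u0) (nz0 V v0).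
exists a, b; split; first exact: (congr1 val ab).
by apply: contra nz => /eqP au0; apply/eqP/val_inj.
Qed.

(** * The size of a uniform module *)

(** Fix a nonzero u in N. For each s, the vectors x with s x in Ru form a
    subgroup; choose a representative r of the coset of x and record a scalar a
    with s (x - r) = a u. If x <> y, then uniformity gives s with
    s (x - y) in Ru and nonzero: for this s the two cosets agree, so the two
    recorded scalars differ. *)
Lemma uniform_on_embedding (R : pzRingType) (M : lmodType R)
    (N : submodClosed M) :
  uniform_on N -> exists phi : M -> R -> R, {in N &, injective phi}.
Proof.
move=> unifN.
have [[u uN u0]|N0] := pselect (exists2 u, u \in N & u != 0); last first.
  exists (fun _ _ => 0) => x y xN yN _; apply/eqP; rewrite -subr_eq0.
  by apply/negPn/negP => xy0; apply: N0; exists (x - y); rewrite ?submod_closedB.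
pose coset s x := fun y => `[< exists a : R, s *: (x - y) = a *: u >].
have coset_refl s x : exists y, coset s x y.
  by exists x; apply/asboolP; exists 0; rewrite subrr scaler0 scale0r.
pose r s x := xchoose (coset_refl s x).
have rP s x : exists a : R, s *: (x - r s x) = a *: u.
  exact/asboolP/(xchooseP (coset_refl s x)).
pose phi x s := projT1 (cid (rP s x)).
have phiE x s : s *: (x - r s x) = phi x s *: u by rewrite /phi; case: cid.
exists phi => x y xN yN eq_phi; apply/eqP; rewrite -subr_eq0.
apply/negPn/negP => xy0.
have [s [b [sb]]] := unifN _ _ (submod_closedB xN yN) uN xy0 u0.
have eq_r : r s x = r s y.
  apply: eq_xchoose => z; apply/asboolP/asboolP => -[a az].
    exists (a - b); rewrite scalerBl -az -sb -scalerBr; congr (_ *: _).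
    by rewrite opprB [RHS]addrC addrA subrK.
  exists (a + b); rewrite scalerDl -az -sb -scalerDr; congr (_ *: _).
  by rewrite [RHS]addrC addrA subrK.
have -> : x - y = (x - r s x) - (y - r s y) by rewrite eq_r opprB addrA subrK.
by rewrite scalerBr !phiE eq_phi subrr eqxx.
Qed.

(** * Components in a direct sum *)

Section DirectSum.
Variables (R : pzRingType) (M : lmodType R) (I : eqType).
Variable N : I -> submodClosed M.
Hypothesis dsN : direct_sum N.

Definition is_components (x : M) (f : I -> M) :=
  (forall i, f i \in N i) /\
  exists s, [/\ uniq s, forall i, i \notin s -> f i = 0 & x = \sum_(i <- s) f i].

Lemma sum_support (s r : seq I) (f : I -> M) :
  uniq s -> uniq r -> {subset s <= r} -> (forall i, i \notin s -> f i = 0) ->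
  \sum_(i <- r) f i = \sum_(i <- s) f i.
Proof.
move=> us ur sr f0; rewrite (bigID (mem s)) /= [X in _ + X]big1 ?addr0 //.
rewrite -big_filter; apply: perm_big; apply: uniq_perm => // [|i].
  exact: filter_uniq.
by rewrite mem_filter; apply: andb_idr; exact: sr.
Qed.

Lemma is_components_lincomb a x y f g : is_components x f -> is_components y g ->
  is_components (a *: x + y) (fun i => a *: f i + g i).
Proof.
move=> [fN [s [us f0 ->]]] [gN [t [ut g0 ->]]]; split=> [i|].
  by rewrite rpredD ?rpredZ.
exists (undup (s ++ t)); split=> [|i|]; first exact: undup_uniq.
  by rewrite mem_undup mem_cat negb_or => /andP[/f0-> /g0->]; rewrite scaler0 addr0.
rewrite big_split -scaler_sumr /=.
congr (_ *: _ + _); apply/esym/sum_support; rewrite ?undup_uniq // => i.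
  by move=> si; rewrite mem_undup mem_cat si.
by move=> it; rewrite mem_undup mem_cat it orbT.
Qed.

Lemma components_unique x f g : is_components x f -> is_components x g -> f =1 g.
Proof.
move=> fx gx; have := is_components_lincomb (-1) gx fx.
rewrite scaleN1r addNr => -[hN [s [us h0 /esym hs]]] i.
have : -1 *: g i + f i = 0.
  by have [/(proj2 dsN s _ us hN hs)|/h0] := boolP (i \in s).
by rewrite scaleN1r addrC => /eqP; rewrite subr_eq0 => /eqP.
Qed.

Lemma components_exist x : exists f, is_components x f.
Proof.
have [s [f [us fN xE]]] := proj1 dsN x.
exists (fun i => if i \in s then f i else 0); split=> [i|].
  by case: ifP => // _; exact: rpred0.
exists s; split=> // [i /negPf-> //|].
by rewrite xE big_seq [RHS]big_seq; apply: eq_bigr => i ->.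
Qed.

Definition component (i : I) (x : M) : M := projT1 (cid (components_exist x)) i.

Lemma componentP x : is_components x (component^~ x).
Proof. by rewrite /component; case: cid. Qed.

Lemma component_in i x : component i x \in N i.
Proof. by have [] := componentP x. Qed.

Lemma component_lincomb i a x y :
  component i (a *: x + y) = a *: component i x + component i y.
Proof.
exact: (components_unique (componentP _)
  (is_components_lincomb a (componentP x) (componentP y))).
Qed.

Lemma component0 i : component i 0 = 0.
Proof.
by have := component_lincomb i (-1) 0 0; rewrite scaleN1r addNr scaleN1r addNr.
Qed.

Lemma componentD i : {morph component i : x y / x + y}.
Proof. by move=> x y; have := component_lincomb i 1 x y; rewrite !scale1r. Qed.

Lemma componentZ i a x : component i (a *: x) = a *: component i x.
Proof. by have := component_lincomb i a x 0; rewrite component0 !addr0. Qed.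

Lemma component_sum i (J : Type) (r : seq J) (P : pred J) (F : J -> M) :
  component i (\sum_(j <- r | P j) F j) = \sum_(j <- r | P j) component i (F j).
Proof. exact: (big_morph _ (@componentD i) (@component0 i)). Qed.

Lemma component_id i j x :
  x \in N j -> component i x = if i == j then x else 0.
Proof.
move=> xN; pose f k := if k == j then x else 0.
apply: (@components_unique x _ f (componentP x)); rewrite /f; split=> [k|].
  by case: eqP => [->|_] //; exact: rpred0.
exists [:: j]; split=> // [k|]; first by rewrite inE => /negPf->.
by rewrite big_seq1 eqxx.
Qed.

Lemma component_support x : exists s,
  [/\ uniq s, forall i, i \notin s -> component i x = 0
    & x = \sum_(i <- s) component i x].
Proof. by have [] := componentP x. Qed.

End DirectSum.

(** * Stationary powers *)

(** Cantor's diagonal argument, giving also a point where the two colliding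
    subsets differ. *)
Lemma powerset_code_collision (A : Type) (code : (A -> bool) -> A) :
  exists f g a, [/\ code f = code g, f a & ~~ g a].
Proof.
pose f a := `[< exists2 g, code g = a & ~~ g a >].
have fd : f (code f).
  by apply/negPn/negP => nfd; case/negP: (nfd); apply/asboolP; exists f.
have [g gf gd] := asboolP _ fd.
by exists f, g, (code f).
Qed.

(** Chase's lemma: multiplied by x^n, the elements w of the product that vanish
    before index n have all components outside a fixed finite set F in
    x^(n+1) M. Otherwise there are successively w_n and new indices j_n for
    which the component of x^n w_n at j_n is not in x^(n+1) M; the infinite sum
    of the x^n w_n makes sense pointwise, and all the components j_n of this
    single element are nonzero. *)
Lemma component_power_stationary (R : pzRingType) (x : R) (A : Type) (I : eqType)
    (N : I -> submodClosed (nat -> A -> R^o)) (dsN : direct_sum N) :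
  exists (n : nat) (F : seq I), forall w : nat -> A -> R^o,
    (forall k a, (k < n)%N -> w k a = 0) ->
    forall j, j \notin F -> exists v, component dsN j (x ^+ n *: w) = x ^+ n.+1 *: v.
Proof.
set M := (nat -> A -> R^o)%type; apply: contrapT => no.
have step n (F : seq I) : exists wj : M * I,
    [/\ forall k a, (k < n)%N -> wj.1 k a = 0, wj.2 \notin F
      & forall v, component dsN wj.2 (x ^+ n *: wj.1) <> x ^+ n.+1 *: v].
  apply: contrapT => nowj; apply: no; exists n, F => w w0 j jF.
  apply: contrapT => nov; apply: nowj; exists (w, j); split=> // v e.
  by apply: nov; exists v.
pose supp y := projT1 (cid (component_support dsN y)).
have suppP y j : j \notin supp y -> component dsN j y = 0.
  by rewrite /supp; case: cid => s [_ + _] /=; exact.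
pose W n F := (projT1 (cid (step n F))).1.
pose J n F := (projT1 (cid (step n F))).2.
(* F n collects the earlier indices and the supports of the earlier x^i w_i. *)
pose F := nat_rect (fun _ => seq I) [::]
  (fun n Fn => J n Fn :: supp (x ^+ n *: W n Fn) ++ Fn).
pose w n : M := W n (F n); pose j n := J n (F n).
have wjP n : [/\ forall k a, (k < n)%N -> w n k a = 0, j n \notin F n
      & forall v, component dsN (j n) (x ^+ n *: w n) <> x ^+ n.+1 *: v].
  by rewrite /w /j /W /J; case: cid.
have FS m n : (m < n)%N ->
    j m \in F n /\ {subset supp (x ^+ m *: w m) <= F n}.
  elim: n => // n IHn; rewrite ltnS leq_eqVlt => /orP[/eqP->|/IHn[jm sm]].
    split=> [|i si]; first exact: mem_head.
    by rewrite inE mem_cat si orbT.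
  by split=> [|i /sm si]; rewrite inE mem_cat ?jm ?si !orbT.
(* As w i k a = 0 for k < i, truncating at i <= k loses nothing. *)
pose v : M := fun k a => \sum_(0 <= i < k.+1) x ^+ i * w i k a.
pose t n : M := fun k a => \sum_(n.+1 <= i < k.+1) x ^+ (i - n.+1) * w i k a.
have vE n : v = \sum_(0 <= i < n) x ^+ i *: w i + x ^+ n *: w n + x ^+ n.+1 *: t n.
  apply/funext => k; apply/funext => a.
  have -> : (\sum_(0 <= i < n) x ^+ i *: w i + x ^+ n *: w n + x ^+ n.+1 *: t n) k a
    = \sum_(0 <= i < n.+1) x ^+ i * w i k a + x ^+ n.+1 * t n k a.
    rewrite big_nat_recr //=; congr (_ + _ + _); rewrite !fct_sumE.
    exact: eq_bigr.
  rewrite /t mulr_sumr.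
  have -> : \sum_(n.+1 <= i < k.+1) x ^+ n.+1 * (x ^+ (i - n.+1) * w i k a)
      = \sum_(n.+1 <= i < k.+1) x ^+ i * w i k a.
    rewrite big_nat [RHS]big_nat; apply: eq_bigr => i /andP[ni _].
    by rewrite mulrA -exprD subnKC.
  have [nk|kn] := leqP n k; first by rewrite -big_cat_nat.
  rewrite [X in _ + X]big_geq ?addr0 1?ltnW //.
  rewrite (@big_cat_nat _ _ _ k.+1 0 n.+1) 1?ltnW //=.
  rewrite [X in _ + X]big_nat [X in _ + X]big1 ?addr0 //.
  move=> i /andP[ki _]; have [w0 _ _] := wjP i.
  by rewrite w0 // mulr0.
have jv n : j n \in supp v.
  apply/negPn/negP => /suppP; rewrite (vE n) !componentD component_sum.
  rewrite big_nat big1 => [|m /andP[_ mn]].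
    rewrite add0r [X in _ + X]componentZ => /eqP; rewrite addr_eq0 => /eqP e.
    have [_ _ /(_ (- component dsN (j n) (t n)))] := wjP n.
    by apply; rewrite e scalerN.
  apply: suppP; have [_ jF _] := wjP n.
  by apply: contra jF; have [_] := FS _ _ mn; apply.
have j_inj : injective j.
  move=> m n; apply: contra_eq; rewrite neq_ltn => /orP[] mn.
    have [_ jF _] := wjP n; apply: contra jF => /eqP<-.
    by have [] := FS _ _ mn.
  have [_ jF _] := wjP m; apply: contra jF => /eqP->.
  by have [] := FS _ _ mn.
have := @uniq_leq_size _ (map j (iota 0 (size (supp v)).+1)) (supp v).
rewrite map_inj_uniq ?iota_uniq // size_map size_iota ltnn.
by move=> /(_ isT) contra_size; apply/notF/contra_size => _ /mapP[i _ ->].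
Qed.

(** For a subset f of A put w_f in position n of the product, where Chase's
    lemma applies. The components of x^n w_f in the finite set F are coded by a
    finite sequence of functions R -> R. With A the type of such sequences,
    two distinct subsets f and g have the same code, so that x^n (w_f - w_g)
    lies in x^(n+1) M; a coordinate where f and g differ shows x^n in
    x^(n+1) R. *)
Lemma power_stationary (R : pzRingType) :
  (forall M : lmodType R, exists (I : eqType) (N : I -> submodClosed M),
     direct_sum N /\ forall i, uniform_on (N i)) ->
  forall x : R, exists (n : nat) (y : R), x ^+ n = x ^+ n.+1 * y.
Proof.
move=> sumU x; pose A := seq (R -> R).
have [I [N [dsN unifN]]] := sumU (nat -> A -> R^o).
have /choice[phi phi_inj] i := uniform_on_embedding (unifN i).
have [n [F stat]] := component_power_stationary x dsN.
pose w (f : A -> bool) : nat -> A -> R^o :=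
  fun k a => if (k == n) && f a then 1 else 0.
pose code f : A := [seq phi j (component dsN j (x ^+ n *: w f)) | j <- F].
have [f [g [a [eq_code fa ga]]]] := powerset_code_collision code.
pose d := w f - w g.
have dF j : exists v, component dsN j (x ^+ n *: d) = x ^+ n.+1 *: v.
  have [jF|jF] := boolP (j \in F); last first.
    apply: stat => // k b kn; rewrite /d /w.
    by rewrite /GRing.add /= /GRing.opp /= ltn_eqF // subrr.
  exists 0; rewrite scaler0 /d scalerBr -scaleN1r addrC component_lincomb.
  rewrite scaleN1r addrC; apply/eqP; rewrite subr_eq0; apply/eqP.
  apply: (phi_inj j); rewrite ?component_in //.
  by move/eq_in_map: eq_code; apply.
have [s [_ _ dE]] := component_support dsN (x ^+ n *: d).
have [v vE] : exists v, x ^+ n *: d = x ^+ n.+1 *: v.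
  have /choice[V VE] := dF; exists (\sum_(i <- s) V i).
  by rewrite dE scaler_sumr; apply: eq_bigr => i _; exact: VE.
exists n, (v n a); have := congr1 (fun h => h n a) vE.
have -> : (x ^+ n *: d) n a = x ^+ n * (w f n a - w g n a) by [].
by rewrite /w eqxx fa (negPf ga) subr0 mulr1.
Qed.

(** * Uniform left ideals in a ring with zero radical *)

Section UniformIdempotent.
Variables (S : pzRingType) (e : S).
(* The Jacobson radical of S is zero: z <> 0 lies outside some maximal left
   ideal, which contains 1 - a z for some a. *)
Hypothesis rad0 : forall z : S, z != 0 -> exists a, forall c, c * (1 - a * z) <> 1.
Hypothesis stationary : forall x : S, exists n y, x ^+ n = x ^+ n.+1 * y.
Hypothesis ee : e * e = e.
(* The left ideal S e is uniform; v lies in S e exactly when v e = v. *)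
Hypothesis unif_e : forall u v : S, u * e = u -> v * e = v -> u != 0 -> v != 0 ->
  exists a b, a * u = b * v /\ a * u != 0.

Lemma nilpotent_multiples_eq0 (z : S) :
  (forall a, exists n, (a * z) ^+ n = 0) -> z = 0.
Proof.
move=> nil; apply/eqP/negPn/negP => /rad0[a noinv]; have [n azn] := nil a.
apply: (noinv (\sum_(i < n) (a * z) ^+ i)).
suff <- : 1 - (a * z) ^+ n = (\sum_(i < n) (a * z) ^+ i) * (1 - a * z).
  by rewrite azn subr0.
have comm_sum : GRing.comm (a * z - 1) (\sum_(i < n) (a * z) ^+ i).
  apply: commr_sum => i _; apply/commrX/commr_sym.
  by apply: commrB; [exact: commr_refl | exact: commr1].
by rewrite -[LHS]opprB subrX1 comm_sum -[LHS]mulrN opprB.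
Qed.

(** Let w = z a e, which kills u like z does. As S e is uniform, the
    endomorphism e - w y of S e is injective for every y: on a common multiple
    of v and u it is the identity. Since w^(n+1) (e - w y) = 0 for suitable n
    and y, w is nilpotent, and so is a z. As a is arbitrary, z is in the
    radical. *)
Lemma corner_regular (z u : S) :
  e * z * e = z -> u * e = u -> u != 0 -> u * z = 0 -> z = 0.
Proof.
move=> ez ue u0 uz; apply: nilpotent_multiples_eq0 => a.
have ez1 : e * z = z by rewrite -ez !mulrA ee.
have ze1 : z * e = z by rewrite -{1}ez -mulrA ee.
have [w wE] : exists w, w = z * a * e by exists (z * a * e).
have ew : e * w = w by rewrite wE !mulrA ez1.
have we : w * e = w by rewrite wE -mulrA ee.
have uw : u * w = 0 by rewrite wE !mulrA uz !mul0r.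
have [n [y wy]] := stationary w.
pose t := e - w * y * e.
have wt : w ^+ n.+1 * t = 0.
  rewrite /t mulrBr -mulrA [X in _ - X]mulrA -exprSr.
  rewrite [X in _ - X]mulrA [w ^+ n.+2]exprS -[w * _ * y]mulrA -wy -exprS.
  by rewrite exprSr -mulrA we subrr.
have t_reg v : v * e = v -> v * t = 0 -> v = 0.
  move=> ve vt; apply/eqP/negPn/negP => v0.
  have [c [d [cd]]] := unif_e ve ue v0 u0.
  suff -> : c * v = c * v * t by rewrite -mulrA vt mulr0 eqxx.
  have cvw : c * v * w = 0 by rewrite cd -mulrA uw mulr0.
  by rewrite /t mulrBr !mulrA cvw !mul0r subr0 -mulrA ve.
have wn0 : w ^+ n.+1 = 0 by apply: t_reg; rewrite // exprSr -mulrA we.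
exists n.+2.
have zaX k : (a * z) ^+ k.+1 = a * w ^+ k * z.
  elim: k => [|k IHk]; first by rewrite expr0 mulr1.
  rewrite exprSr IHk exprSr wE !mulrA -[_ * e * z]mulrA ez1.
  by [].
by rewrite zaX wn0 mulr0 mul0r.
Qed.

(** Write x^n = x^(n+1) y. Then x^(n+1) (e - x y e) = 0 with x^(n+1) <> 0 by
    [corner_regular], which applied once more gives e = x y e. *)
Lemma corner_division (x : S) :
  e * x * e = x -> x != 0 -> exists y, e * y * e = y /\ x * y = e.
Proof.
move=> xE x0; have ex : e * x = x by rewrite -xE !mulrA ee.
have xe : x * e = x by rewrite -{1}xE -mulrA ee.
have [n [y xy]] := stationary x.
pose t := e - x * y * e.
have xn k : x ^+ k.+1 != 0 /\ x ^+ k.+1 * e = x ^+ k.+1.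
  elim: k => [|k [nz IHk]]; first by rewrite expr1.
  split; last by rewrite exprSr -mulrA xe.
  apply: contra x0; rewrite exprSr => /eqP xkx; apply/eqP.
  exact: (corner_regular xE IHk nz xkx).
have t0 : t = 0.
  have [nz xke] := xn n.
  apply: (corner_regular _ xke nz).
    by rewrite /t mulrBr mulrBl ee ee !mulrA ex -[_ * e * e]mulrA ee.
  rewrite /t mulrBr xke -mulrA [X in _ - X]mulrA -exprSr.
  rewrite [X in _ - X]mulrA [x ^+ n.+2]exprS -[x * _ * y]mulrA -xy -exprS.
  by rewrite xke subrr.
exists (e * y * e); split; first by rewrite !mulrA ee -mulrA ee.
by rewrite !mulrA xe; apply/esym/eqP; rewrite -subr_eq0; apply/eqP.
Qed.

(** If e S u = 0, then S u is an ideal of square zero, which is impossible in a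
    ring with zero radical. Hence S u meets the division ring e S e. *)
Lemma uniform_idempotent_minimal (u : S) :
  u * e = u -> u != 0 -> exists a, a * u = e.
Proof.
move=> ue u0.
have [s esu] : exists s, e * s * u != 0.
  apply: contrapT => no; case/eqP: u0; apply: nilpotent_multiples_eq0 => a.
  exists 2%N; suff eau : e * a * u = 0.
    by rewrite expr2 -{1}ue !mulrA -[_ * e * a]mulrA -[_ * (e * a) * u]mulrA
      eau mulr0.
  by apply/eqP/negPn/negP => nz; apply: no; exists a.
have corner_x : e * (e * s * u) * e = e * s * u.
  by rewrite !mulrA ee -[_ * u * e]mulrA ue.
have [y [yE xy]] := corner_division corner_x esu.
have y0 : y != 0.
  apply: contra esu => /eqP yz; move: xy; rewrite yz mulr0 => e0.
  by rewrite -corner_x -e0 !mul0r.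
have [z [zE yz]] := corner_division yE y0.
have xz : e * s * u = z.
  have ez : e * z = z by rewrite -zE !mulrA ee.
  have xe : e * s * u * e = e * s * u by rewrite -mulrA ue.
  have -> : e * s * u = e * s * u * (y * z) by rewrite yz xe.
  by rewrite mulrA xy ez.
by exists (y * (e * s)); rewrite -mulrA xz yz.
Qed.

End UniformIdempotent.

(** * The corner ring of an idempotent *)

Section CornerRing.
Variables (S : pzRingType) (e : S).

Definition in_corner : pred S := fun x => e * x * e == x.

Lemma in_corner_zmod_closed : zmod_closed in_corner.
Proof.
split=> [|x y /eqP xE /eqP yE]; first by rewrite unfold_in /in_corner mulr0 mul0r.
by rewrite unfold_in /in_corner mulrBr mulrBl xE yE.
Qed.

HB.instance Definition _ := GRing.isZmodClosed.Build S in_corner in_corner_zmod_closed.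

(** The two proofs are parameters of the type because the ring structure on it
    needs them. *)
Record corner (ee : e * e = e) (e0 : e != 0) :=
  Corner { corner_val : S; _ : corner_val \in in_corner }.

Hypotheses (ee : e * e = e) (e0 : e != 0).
Local Notation eSe := (corner ee e0).

HB.instance Definition _ := [isSub for @corner_val ee e0].
HB.instance Definition _ := [Choice of eSe by <:].
HB.instance Definition _ := [SubChoice_isSubZmodule of eSe by <:].

Lemma in_cornerP (x : S) : reflect (e * x * e = x) (x \in in_corner).
Proof. exact: eqP. Qed.

Lemma corner_mull (x : eSe) : e * val x = val x.
Proof. by rewrite -(in_cornerP _ (valP x)) !mulrA ee. Qed.

Lemma corner_mulr (x : eSe) : val x * e = val x.
Proof. by rewrite -(in_cornerP _ (valP x)) -!mulrA ee. Qed.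

Fact corner_one_subproof : e \in in_corner.
Proof. by apply/in_cornerP; rewrite !ee. Qed.

Fact corner_mul_subproof (x y : eSe) : val x * val y \in in_corner.
Proof. by apply/in_cornerP; rewrite mulrA corner_mull -mulrA corner_mulr. Qed.

Definition corner_one : eSe := Corner ee e0 corner_one_subproof.
Definition corner_mul (x y : eSe) : eSe := Corner ee e0 (corner_mul_subproof x y).

Fact corner_mulA : associative corner_mul.
Proof. by move=> x y z; apply: val_inj; rewrite /= mulrA. Qed.
Fact corner_mul1l : left_id corner_one corner_mul.
Proof. by move=> x; apply: val_inj; exact: corner_mull. Qed.
Fact corner_mul1r : right_id corner_one corner_mul.
Proof. by move=> x; apply: val_inj; exact: corner_mulr. Qed.
Fact corner_mulDl : left_distributive corner_mul +%R.
Proof. by move=> x y z; apply: val_inj; exact: mulrDl. Qed.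
Fact corner_mulDr : right_distributive corner_mul +%R.
Proof. by move=> x y z; apply: val_inj; exact: mulrDr. Qed.
Fact corner_oner_neq0 : corner_one != 0.
Proof. by apply: contra e0 => /eqP /(congr1 val) /eqP. Qed.

HB.instance Definition _ := GRing.Zmodule_isNzRing.Build eSe
  corner_mulA corner_mul1l corner_mul1r corner_mulDl corner_mulDr corner_oner_neq0.

Lemma corner_principal_left_ideal_domain :
  (forall x : eSe, x != 0 -> exists y : eSe, y * x = 1) ->
  principal_left_ideal_domain eSe.
Proof.
move=> inv; split=> [x y xy|L].
  have [->|/inv[z zx]] := eqVneq x 0; [by left | right].
  by rewrite -[y]mul1r -zx -mulrA xy mulr0.
have [[x xL x0]|L0] := pselect (exists2 x : eSe, (x : eSe^o) \in L & x != 0).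
  have [z zx] := inv x x0; exists 1 => y; split=> _; first by exists y; rewrite mulr1.
  rewrite -[y]mulr1 -zx mulrA; exact (@rpredZ _ _ L (y * z) x xL).
exists 0 => y; split=> [yL|[c ->]]; last by rewrite mulr0; exact: (rpred0 L).
exists 0; rewrite mulr0; apply/eqP/negPn/negP => y0; apply: L0.
by exists y.
Qed.

End CornerRing.

(** * The Wedderburn-Artin decomposition *)

Section WedderburnArtin.
Variables (S : pzRingType) (m : nat) (e : 'I_m -> S).
Hypothesis e_neq0 : forall i, e i != 0.
Hypothesis e_orth : forall i j, e i * e j = if i == j then e i else 0.
Hypothesis e_sum : \sum_i e i = 1.
(* The left ideal S (e i) is simple. *)
Hypothesis e_min : forall i (u : S), u * e i = u -> u != 0 -> exists a, a * u = e i.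

Let e_idem i : e i * e i = e i.
Proof. by rewrite e_orth eqxx. Qed.

(** Schur's lemma: an element of e_i S e_j is a homomorphism between the simple
    modules S e_i and S e_j. *)
Lemma peirce_inverse i j (x : S) : e i * x * e j = x -> x != 0 ->
  exists y, [/\ e j * y * e i = y, y * x = e j & x * y = e i].
Proof.
have half i' j' (z : S) : e i' * z * e j' = z -> z != 0 ->
    exists y, e j' * y * e i' = y /\ y * z = e j'.
  move=> zE z0; have [a az] : exists a, a * z = e j'.
    by apply: e_min z0; rewrite -zE -mulrA e_idem.
  exists (e j' * a * e i'); split; first by rewrite !mulrA e_idem -mulrA e_idem.
  have ez : e i' * z = z by rewrite -zE !mulrA e_idem.
  by rewrite -mulrA ez -mulrA az e_idem.
move=> xE x0; have [y [yE yx]] := half _ _ _ xE x0.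
have y0 : y != 0.
  by apply: contraNneq (e_neq0 j) => y0; rewrite -yx y0 mul0r.
have [x' [x'E x'y]] := half _ _ _ yE y0.
exists y; split=> //; rewrite -x'y; congr (_ * _).
have ex : e i * x = x by rewrite -xE !mulrA e_idem.
have x'e : x' * e j = x' by rewrite -x'E -mulrA e_idem.
by rewrite -x'e -yx mulrA x'y ex.
Qed.

(** Linked idempotents are those that generate isomorphic left ideals; the
    classes of this relation index the blocks. *)
Definition linked i j := `[< exists s, e i * s * e j != 0 >].

Let corner_eq i j (s : S) : e i * (e i * s * e j) * e j = e i * s * e j.
Proof. by rewrite !mulrA e_idem -mulrA e_idem. Qed.

Lemma linked_equiv : equivalence_rel linked.
Proof.
have refl i : linked i i by apply/asboolP; exists 1; rewrite mulr1 e_idem.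
have sym i j : linked i j -> linked j i.
  move=> /asboolP[s nz]; have [y [yE yx _]] := peirce_inverse (corner_eq i j s) nz.
  apply/asboolP; exists y; rewrite yE.
  by apply: contraNneq (e_neq0 j) => y0; rewrite -yx y0 mul0r.
have trans i j k : linked i j -> linked j k -> linked i k.
  move=> /asboolP[s nz] /asboolP[t]; apply: contraNT => no.
  have [y [yE yx _]] := peirce_inverse (corner_eq i j s) nz.
  have st : e i * s * e j * (e j * t * e k) = 0.
    apply/eqP/negPn/negP => nz2; case/negP: no; apply/asboolP.
    by exists (s * e j * e j * t); rewrite !mulrA in nz2 *.
  have := congr1 ( *%R y) st; rewrite mulr0 mulrA yx !mulrA e_idem => ->.
  by rewrite eqxx.
move=> i j k; split=> // ij; apply/idP/idP; last exact: trans.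
by apply: trans; exact: sym.
Qed.

Definition class_rep i := odflt i [pick j | linked i j].

Lemma linked_class_rep i : linked i (class_rep i).
Proof.
rewrite /class_rep; case: pickP => [j //|/(_ i)].
by have [-> _] := linked_equiv i i i.
Qed.

Lemma linked_class i j : linked i j = (class_rep i == class_rep j).
Proof.
have [refl _] := linked_equiv i i i.
apply/idP/eqP => [ij|eq_rep].
  have eq_ij : linked i =1 linked j.
    by move=> k; have [_ ->] := linked_equiv i j k.
  rewrite /class_rep (eq_pick eq_ij); case: pickP => // /(_ j).
  by have [-> _] := linked_equiv j j j.
have [_ tr] := linked_equiv i (class_rep i) j.
rewrite (tr (linked_class_rep i)) eq_rep.
have [_ <-] := linked_equiv j (class_rep j) j; last exact: linked_class_rep.
by have [-> _] := linked_equiv j j j.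
Qed.

Definition reps : {set 'I_m} := [set class_rep i | i : 'I_m].
Definition class_of (c : 'I_#|reps|) : {set 'I_m} :=
  [set i | class_rep i == enum_val c].

Lemma class_of_linked c i : i \in class_of c -> linked (enum_val c) i.
Proof.
rewrite inE linked_class => /eqP ->.
have /imsetP[j _ ->] := enum_valP c.
by rewrite eq_sym -linked_class linked_class_rep.
Qed.

Lemma unlinked_eq0 i j s : ~~ linked i j -> e i * s * e j = 0.
Proof. by apply: contraNeq => nz; apply/asboolP; exists s. Qed.

(** Mutually inverse isomorphisms between S e_i and the left ideal of the
    representative of i. The products y_i x_j serve as matrix units inside a
    block. *)
Lemma exists_transition : exists x y : 'I_m -> S,
  [/\ forall i, e (class_rep i) * x i = x i,
      forall i, y i * e (class_rep i) = y i,
      forall i, y i * x i = e i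
    & forall i j, x i * y j = if i == j then e (class_rep i) else 0].
Proof.
have ex i : exists xy : S * S, [/\ e (class_rep i) * xy.1 * e i = xy.1,
    e i * xy.2 * e (class_rep i) = xy.2, xy.2 * xy.1 = e i
    & xy.1 * xy.2 = e (class_rep i)].
  have : linked (class_rep i) i.
    by rewrite linked_class eq_sym -linked_class linked_class_rep.
  move=> /asboolP[s nz]; have [y [yE yx xy]] := peirce_inverse (corner_eq _ _ s) nz.
  by exists (e (class_rep i) * s * e i, y); rewrite /= corner_eq.
have /choice[xy xyP] := ex.
exists (fun i => (xy i).1), (fun i => (xy i).2); split=> [i|i|i|i j].
- by have [<- _ _ _] := xyP i; rewrite !mulrA e_idem.
- by have [_ <- _ _] := xyP i; rewrite -mulrA e_idem.
- by have [_ _ ] := xyP i.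
- have [[xi _ _ xyi] [_ yj _ _]] := (xyP i, xyP j).
  case: eqP => [<-//|/eqP/negPf ij].
  by rewrite -xi -yj -!mulrA [e i * (e j * _)]mulrA e_orth ij mul0r !mulr0.
Qed.

Local Notation D := (fun c : 'I_#|reps| =>
  corner (e_idem (enum_val c)) (e_neq0 (enum_val c))).
Local Notation n := (fun c : 'I_#|reps| => #|class_of c|).

Lemma corner_division_principal c : principal_left_ideal_domain (D c).
Proof.
apply: corner_principal_left_ideal_domain => x x0.
have [|y [yE yx _]] := @peirce_inverse (enum_val c) (enum_val c) (val x) _ x0.
  exact/in_cornerP/valP.
by exists (Corner (e_idem (enum_val c)) (e_neq0 (enum_val c))
  (introT (in_cornerP _ _) yE)); apply: val_inj.
Qed.

Lemma class_size_gt0 c : (0 < #|class_of c|)%N.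
Proof.
have /imsetP[j _ jE] := enum_valP c.
by apply/card_gt0P; exists j; rewrite inE -jE.
Qed.

Section Blocks.
Variables (x y : 'I_m -> S).
Hypothesis xl : forall i, e (class_rep i) * x i = x i.
Hypothesis yr : forall i, y i * e (class_rep i) = y i.
Hypothesis yx : forall i, y i * x i = e i.
Hypothesis xy : forall i j, x i * y j = if i == j then e (class_rep i) else 0.

Let xr i : x i * e i = x i.
Proof. by rewrite -yx mulrA xy eqxx xl. Qed.

Definition member c (i : 'I_(n c)) : 'I_m := enum_val i.

Lemma class_rep_member c (i : 'I_(n c)) : class_rep (member i) = enum_val c.
Proof. by have := enum_valP i; rewrite inE => /eqP. Qed.

Fact entry_subproof c (i j : 'I_(n c)) (s : S) :
  x (member i) * s * y (member j) \in in_corner (e (enum_val c)).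
Proof.
apply/in_cornerP; rewrite -{1}(class_rep_member i) -(class_rep_member j).
by rewrite !mulrA xl -[_ * y _ * e _]mulrA yr.
Qed.

Definition to_blocks (s : S) : prodring (fun c => 'M[D c]_(n c)) :=
  [ffun c => \matrix_(i, j)
    (Corner (e_idem (enum_val c)) (e_neq0 (enum_val c)) (entry_subproof i j s) : D c)].

Definition of_blocks (d : prodring (fun c => 'M[D c]_(n c))) : S :=
  \sum_c \sum_i \sum_j y (member i) * val (d c i j) * x (member j).

Lemma to_blocksE s c i j :
  val (to_blocks s c i j) = x (member i) * s * y (member j).
Proof. by rewrite ffunE mxE. Qed.

Lemma corner_val_sum c (J : Type) (r : seq J) (P : pred J) (F : J -> D c) :
  val (\sum_(j <- r | P j) F j) = \sum_(j <- r | P j) val (F j).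
Proof. exact: (big_morph val (id1 := 0) (op1 := +%R)). Qed.

(** The Peirce components e_i s e_j outside the class of i vanish, so that
    restricting the sum to the class still gives the whole row. *)
Lemma sum_class_right c i (s : S) : class_rep i = enum_val c ->
  \sum_(j in class_of c) e i * s * e j = e i * s.
Proof.
move=> ic; rewrite -[RHS]mulr1 -e_sum mulr_sumr [RHS](bigID (mem (class_of c))) /=.
rewrite [X in _ + X]big1 ?addr0 // => j; rewrite inE -ic => jc.
by apply: unlinked_eq0; rewrite linked_class eq_sym.
Qed.

Fact to_blocks_is_zmod_morphism : zmod_morphism to_blocks.
Proof.
move=> s t; apply/ffunP => c; apply/matrixP => i j; apply: val_inj.
rewrite to_blocksE mulrBr mulrBl -!to_blocksE.
by rewrite !ffunE !mxE.
Qed.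

Fact to_blocks_is_monoid_morphism : monoid_morphism to_blocks.
Proof.
split.
  apply/ffunP => c; apply/matrixP => i j; apply: val_inj.
  rewrite to_blocksE mulr1 xy class_rep_member !ffunE !mxE.
  by rewrite /member (inj_eq enum_val_inj); case: eqP.
move=> s t; apply/ffunP => c; apply/matrixP => i k; apply: val_inj.
rewrite to_blocksE ffunE mxE corner_val_sum.
have -> : x (member i) * (s * t) * y (member k) =
    \sum_(j in class_of c) x (member i) * (e (member i) * s * e j) * (t * y (member k)).
  rewrite -mulr_suml -mulr_sumr sum_class_right ?class_rep_member //.
  by rewrite !mulrA xr.
rewrite big_enum_val; apply: eq_bigr => j _.
have -> : val (to_blocks s c i j * to_blocks t c j k) =
  val (to_blocks s c i j) * val (to_blocks t c j k) by [].
by rewrite !to_blocksE !mulrA xr -yx !mulrA.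
Qed.

HB.instance Definition _ := GRing.isZmodMorphism.Build S
  (prodring (fun c => 'M[D c]_(n c))) to_blocks to_blocks_is_zmod_morphism.
HB.instance Definition _ := GRing.isMonoidMorphism.Build S
  (prodring (fun c => 'M[D c]_(n c))) to_blocks to_blocks_is_monoid_morphism.

Lemma to_blocksK : cancel to_blocks of_blocks.
Proof.
move=> s; rewrite /of_blocks.
have cE (c : 'I_#|reps|) :
    \sum_(i < n c) \sum_(j < n c)
      y (member i) * val (to_blocks s c i j) * x (member j)
    = \sum_(i | class_rep i == enum_val c) e i * s.
  rewrite (eq_bigl (fun i => i \in class_of c)) => [|i]; last by rewrite inE.
  rewrite [RHS]big_enum_val; apply: eq_bigr => i _.
  rewrite -(sum_class_right _ (class_rep_member i)) [RHS]big_enum_val.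
  by apply: eq_bigr => j _; rewrite to_blocksE !mulrA yx -mulrA yx.
rewrite (eq_bigr _ (fun c _ => cE c)).
transitivity (\sum_(p in reps) \sum_(i | class_rep i == p) e i * s).
  by rewrite [RHS]big_enum_val.
rewrite -[RHS]mul1r -e_sum mulr_suml; apply/esym/partition_big => i _.
exact: imset_f.
Qed.

Lemma of_blocksK : cancel of_blocks to_blocks.
Proof.
move=> d; apply/ffunP => c; apply/matrixP => i k; apply: val_inj.
have xyM c' (i' j' : 'I_(n c')) : i' != j' -> x (member i') * y (member j') = 0.
  by move=> ij; rewrite xy (inj_eq enum_val_inj) (negPf ij).
have xyC c' (j' : 'I_(n c')) : c' != c -> x (member i) * y (member j') = 0.
  move=> cc'; rewrite xy; case: eqP => // eq_ij; case/eqP: cc'.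
  by apply: enum_val_inj; rewrite -(class_rep_member i) eq_ij class_rep_member.
rewrite to_blocksE /of_blocks mulr_sumr mulr_suml (bigD1 c) //=.
rewrite [X in _ + X]big1 ?addr0 => [|c' cc']; last first.
  rewrite mulr_sumr mulr_suml big1 // => i' _.
  rewrite mulr_sumr mulr_suml big1 // => j' _.
  by rewrite !mulrA xyC // !mul0r.
rewrite mulr_sumr mulr_suml (bigD1 i) //= [X in _ + X]big1 ?addr0; last first.
  move=> i' ii'; rewrite mulr_sumr mulr_suml big1 // => j' _.
  by rewrite !mulrA xyM ?mul0r // eq_sym.
rewrite mulr_sumr mulr_suml (bigD1 k) //= [X in _ + X]big1 ?addr0; last first.
  by move=> j' jk; rewrite -!mulrA xyM // !mulr0.
rewrite !mulrA xy eqxx class_rep_member -mulrA xy eqxx class_rep_member.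
by rewrite corner_mull corner_mulr.
Qed.

Lemma to_blocks_isomorphism : ring_isomorphic S (prodring (fun c => 'M[D c]_(n c))).
Proof.
by exists to_blocks; exists of_blocks; [exact: to_blocksK | exact: of_blocksK].
Qed.

End Blocks.

Theorem wedderburn_artin :
  exists (k : nat) (n : 'I_k -> nat) (D : 'I_k -> nzRingType),
    [/\ forall i, (0 < n i)%N,
        forall i, principal_left_ideal_domain (D i) &
        ring_isomorphic S (prodring (fun i => 'M[D i]_(n i)))].
Proof.
have [x [y [xl yr yx xy]]] := exists_transition.
exists #|reps|, n, D; split; [exact: class_size_gt0 | exact: corner_division_principal |].
exact: (to_blocks_isomorphism xl yr yx xy).
Qed.

End WedderburnArtin.

(** * The quotient by the Jacobson radical *)

Section JacobsonQuotientFacts.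
Variable R : pzRingType.
Local Notation S := (jquot R).
Local Notation pi := (\pi_S%qT : R -> S).

Let piM (a b : R) : pi (a * b) = pi a * pi b.
Proof. by rewrite -[RHS]/(jquot_mul (pi a) (pi b)) jquot_mulE. Qed.

Let piX (a : R) n : pi (a ^+ n) = pi a ^+ n.
Proof. by elim: n => [|n IHn] //; rewrite !exprS piM IHn. Qed.

Let piB (a b : R) : pi (a - b) = pi a - pi b.
Proof.
apply/eqP; rewrite eq_sym subr_eq; apply/eqP; rewrite -[LHS]/(pi a).
by rewrite -jquot_piD subrK.
Qed.

Lemma jquot_radical_zero (z : S) : z != 0 -> exists a, forall c, c * (1 - a * z) <> 1.
Proof.
rewrite -[z]reprK; set x : R := repr z => z0.
have : (x : R^o) \notin jacobson R.
  by have := @quotmod_pi_eq0 R R^o (jacobson R) x => <-.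
move=> /radP/existsNP[N /not_implyP[maxN /negP xN]].
have [[y yN] maxN'] := maxN.
have full : (1 : R^o) \in adjoin N x.
  have [eqN|] := maxN' _ (@sub_adjoin _ _ N x); last by apply.
  by case/negP: xN; rewrite -eqN mem_adjoin.
have /adjoinP[a axN] := full.
exists (pi a) => c; rewrite -[c]reprK; set b : R := repr c => bE.
have : (b * (1 - a * x) - 1 : R^o) \in jacobson R.
  have e : pi (b * (1 - a * x)) = pi 1 by rewrite piM piB piM.
  exact: (introT (@jquot_eqP R _ _) e).
move=> /radP/(_ N maxN) N1; case/negP: yN.
have bN : (b * (1 - a * x) : R^o) \in N.
  apply: (@rpredZ _ _ N b); rewrite -[X in X \in _]opprB.
  exact: submod_closedN.
have : (1 : R^o) \in N.
  by rewrite -(subKr (b * (1 - a * x) : R^o) 1) submod_closedB.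
by move=> /(@rpredZ _ _ N y); rewrite [y *: _]mulr1.
Qed.

Lemma jquot_stationary :
  (forall x : R, exists n y, x ^+ n = x ^+ n.+1 * y) ->
  forall x : S, exists n y, x ^+ n = x ^+ n.+1 * y.
Proof.
move=> st x; have [n [y xy]] := st (repr x); exists n, (pi y).
by rewrite -[x]reprK -piX -[_ ^+ n.+1]piX -piM -xy.
Qed.

(** The components of 1 in a decomposition of R/J(R) are orthogonal idempotents,
    and right multiplication by one of them is the projection onto its
    summand. The zero ones are dropped. *)
Lemma jquot_uniform_idempotents (I : eqType)
    (N : I -> submodClosed (quotmod (jacobson R))) :
  direct_sum N -> (forall i, uniform_on (N i)) ->
  exists (m : nat) (e : 'I_m -> S),
   [/\ forall i, e i != 0, forall i j, e i * e j = if i == j then e i else 0,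
       \sum_i e i = 1
     & forall i (u v : S), u * e i = u -> v * e i = v -> u != 0 -> v != 0 ->
       exists a b, a * u = b * v /\ a * u != 0].
Proof.
move=> dsN unifN; pose f i : S := component dsN i (1 : S).
have scaleE (a : R) (u : S) : (a *: (u : quotmod (jacobson R)) : S) = pi a * u.
  by rewrite -[u]reprK -piM; exact: quotmod_scale_pi.
have compE i (u : S) : component dsN i u = u * f i.
  rewrite -{2}[u]reprK -scaleE -componentZ; congr component.
  by rewrite [RHS]scaleE reprK mulr1.
have f_orth i j : f i * f j = if i == j then f i else 0.
  rewrite -compE eq_sym; exact: (component_id dsN j (component_in dsN i (1 : S))).
have [s [us _ sE]] := component_support dsN (1 : S).
pose t := in_tuple [seq i <- s | f i != 0].
have ut : uniq t by exact: filter_uniq.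
eexists _, (fun i => f (tnth t i)); split.
- move=> i; have := mem_tnth i t; rewrite mem_filter.
  by case/andP.
- by move=> i j; rewrite f_orth (inj_eq (elimT (tuple_uniqP _) ut)).
- rewrite -(big_tnth _ _ t xpredT f) /t big_filter [RHS]sE.
  rewrite [RHS](bigID (fun i => f i == 0)) /= [X in X + _]big1 ?add0r // => i /eqP.
  exact: id.
- move=> i u v; set k := tnth _ i => uf vf u0 v0.
  have inN (w : S) : w * f k = w -> (w : quotmod (jacobson R)) \in N k.
    by move=> <-; rewrite -compE component_in.
  have [a [b [ab nz]]] := unifN k u v (inN u uf) (inN v vf) u0 v0.
  by exists (pi a), (pi b); rewrite -!scaleE.
Qed.

End JacobsonQuotientFacts.

Theorem theorem3p4 (R : pzRingType)
    (cuR : forall M : lmodType R, cu_serial M) :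
  exists (k : nat) (n : 'I_k -> nat) (D : 'I_k -> nzRingType),
    [/\ forall i, (0 < n i)%N,
        forall i, principal_left_ideal_domain (D i) &
        ring_isomorphic (jquot R) (prodring (fun i => 'M[D i]_(n i)))].
Proof.
have sumU (M : lmodType R) : exists (I : eqType) (N : I -> submodClosed M),
    direct_sum N /\ forall i, uniform_on (N i).
  have [I [N [dsN cuN]]] := cuR M; exists I, N; split=> // i.
  exact: cu_uniserial_uniform_on.
have stat := jquot_stationary (power_stationary sumU).
have [I [N [dsN unifN]]] := sumU (quotmod (jacobson R)).
have [m [e [e0 eo es eu]]] := jquot_uniform_idempotents dsN unifN.
apply: (wedderburn_artin e0 eo es) => i u.
apply: uniform_idempotent_minimal => //; first exact: jquot_radical_zero.
  by rewrite eo eqxx.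
exact: eu.
Qed.
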